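(* Let $V$ be the continuous piecewise affine function with $V(x)=g_k^\top x+b_k$ for $x\in Y_k$, $k\in\{0,\dots,m\}$. Suppose that $$\forall\, k\in\{1,\dots,m\},\ \forall\, x\in Y_k,\ \forall\, v\in F(x),\qquad v^\top g_k<0 .$$ Then for all $a\in\mathbb{R}$ such that $L_a^V\subset X$, it holds that $L_a^V\subset R$, i.e. $$\forall\, x_0\in L_a^V,\qquad \lim_{t\to\infty}\|x(t|x_0)\|=0 .$$
   Context: Setting. $X\subset\mathbb{R}^d$ is a bounded open set and $f:X\to\mathbb{R}^d$ is a vector field. The system is $\dot x=f(x)$ with the constraint $x(t)\in X$ for all $t\ge 0$. $\|\cdot\|$ is the $q$-norm on $\mathbb{R}^d$ for a fixed $q\in[1,\infty]$. Standing assumptions: 1. $f$ is Lipschitz continuous on $X$, and $x(t|x_0)$ denotes the solution at time $t$ with $x(0)=x_0$. $f$ has a single equilibrium point in $X$, which is the origin $0$, and it is locally asymptotically stable. 2. A finite dataset $D=\{(x_i,f_i)\}_{i=1}^n\subset X\times\mathbb{R}^d$ with $f_i=f(x_i)$ is given. 3. $F$ is a set-valued map (constructed from $D$ and side information), defined on $\overline X$ with values subsets of $\mathbb{R}^d$, such that for all $x\in X$, $F(x)$ is compact and convex and $f(x)\in F(x)$. 4. $A$ is a compact set with $A\subset\mathrm{int}(R)$ and $0\in\mathrm{int}(A)$, where $R=\{x_0\in X:\lim_{t\to\infty}\|x(t|x_0)\|=0\}$ is the region of attraction (trajectories being solutions of the constrained system, i.e. defined and staying in $X$ for all $t\ge0$).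 5. $\overline X$ and $A$ are polytopes, a polytope being a bounded finite union of polyhedra (finite intersections of half-spaces), not necessarily convex. Tessellation. $Y_1,\dots,Y_m$ are convex polytopes with $\overline{X\setminus A}=\bigcup_{k=1}^m Y_k$ and $\mathrm{int}(Y_k)\cap\mathrm{int}(Y_{k'})=\varnothing$ for $k\ne k'$; and $Y_0=A$. Lyapunov candidate. $g_k\in\mathbb{R}^d$, $b_k\in\mathbb{R}$ ($0\le k\le m$) are such that the function $V$ with $V(x)=g_k^\top x+b_k$ for $x\in Y_k$ is well defined and continuous (in particular $(g_k-g_{k'})^\top y=b_{k'}-b_k$ at every common vertex $y$ of $Y_k$ and $Y_{k'}$). $V$ is then Lipschitz, and it is extended to a Lipschitz continuous function on $\mathbb{R}^d$ with the same Lipschitz constant, still denoted $V$. $L_a^V=\{x\in\mathbb{R}^d:V(x)<a\}$. *)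

(* Defs.v *)
From HB Require Import structures.
From mathcomp Require Import all_boot all_order all_algebra.
From mathcomp Require Import all_classical all_reals all_analysis.

Set Implicit Arguments.
Unset Strict Implicit.
Unset Printing Implicit Defensive.
Import Order.TTheory GRing.Theory Num.Theory.
Import numFieldNormedType.Exports.
Local Open Scope classical_set_scope.
Local Open Scope ring_scope.

Definition dot (R : realType) (d : nat) (u v : 'rV[R]_d) : R :=
  \sum_(i < d) u 0 i * v 0 i.

(* For q = +oo this is the library's norm on matrices, the largest absolute
   value of an entry; the value at -oo is junk, as only 1 <= q is used. *)
Definition qnorm (R : realType) (d : nat) (q : \bar R) (x : 'rV[R]_d) : R :=
  match q with
  | r%:E => (\sum_(i < d) `|x 0 i| `^ r) `^ r^-1
  | +oo%E => `|x|
  | -oo%E => 0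
  end.

Definition lipschitz_field (R : realType) (d : nat) (q : \bar R)
    (X : set 'rV[R]_d) (f : 'rV[R]_d -> 'rV[R]_d) : Prop :=
  exists L : R, forall x y, X x -> X y ->
    qnorm q (f x - f y) <= L * qnorm q (x - y).

Definition lipschitz_bound (R : realType) (d : nat) (q : \bar R)
    (S : set 'rV[R]_d) (V : 'rV[R]_d -> R) (L : R) : Prop :=
  0 <= L /\ forall x y, S x -> S y -> `|V x - V y| <= L * qnorm q (x - y).

(* The (best) Lipschitz constant of V on S. *)
Definition lipschitz_constant (R : realType) (d : nat) (q : \bar R)
    (S : set 'rV[R]_d) (V : 'rV[R]_d -> R) (L : R) : Prop :=
  lipschitz_bound q S V L /\
  forall L', lipschitz_bound q S V L' -> L <= L'.

(* x is a solution of x' = f(x), x(0) = x0, that is defined and stays in X for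
   all times t >= 0; the values of x at negative times are irrelevant.  The
   equation at t = 0, with the right derivative, follows by continuity when f
   is continuous on X. *)
Definition trajectory (R : realType) (d : nat) (X : set 'rV[R]_d)
    (f : 'rV[R]_d -> 'rV[R]_d) (x0 : 'rV[R]_d) (x : R -> 'rV[R]_d) : Prop :=
  [/\ x 0 = x0,
      forall t : R, 0 <= t -> X (x t),
      {within `[0, +oo[%classic, continuous x} &
      forall t : R, 0 < t -> is_derive t (1 : R) x (f (x t))].

Definition tends_to_origin (R : realType) (d : nat) (q : \bar R)
    (x : R -> 'rV[R]_d) : Prop :=
  qnorm q (x t) @[t --> +oo] --> (0 : R).

(* Trajectories are unique for Lipschitz f, so "there is a trajectory from x0
   with property P" reads "the trajectory from x0 exists and satisfies P", here
   and in the next definition. *)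
Definition region_of_attraction (R : realType) (d : nat) (q : \bar R)
    (X : set 'rV[R]_d) (f : 'rV[R]_d -> 'rV[R]_d) : set 'rV[R]_d :=
  [set x0 | X x0 /\
    exists x : R -> 'rV[R]_d, trajectory X f x0 x /\ tends_to_origin q x].

Definition locally_asymptotically_stable (R : realType) (d : nat) (q : \bar R)
    (X : set 'rV[R]_d) (f : 'rV[R]_d -> 'rV[R]_d) : Prop :=
  (forall e : R, 0 < e -> exists2 r : R, 0 < r &
     forall x0, X x0 -> qnorm q x0 < r ->
     exists x : R -> 'rV[R]_d,
       trajectory X f x0 x /\ forall t : R, 0 <= t -> qnorm q (x t) < e) /\
  (exists2 r : R, 0 < r &
     forall x0, X x0 -> qnorm q x0 < r ->
     exists x : R -> 'rV[R]_d, trajectory X f x0 x /\ tends_to_origin q x).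

Definition single_equilibrium (R : realType) (d : nat)
    (X : set 'rV[R]_d) (f : 'rV[R]_d -> 'rV[R]_d) : Prop :=
  forall x, X x -> (f x = 0 <-> x = 0).

(* A zero normal C i only contributes the empty set or the whole space. *)
Definition polyhedron (R : realType) (d : nat) (P : set 'rV[R]_d) : Prop :=
  exists (p : nat) (C : 'I_p -> 'rV[R]_d) (c : 'I_p -> R),
    P = [set x | forall i, dot (C i) x <= c i].

Definition polytope (R : realType) (d : nat) (P : set 'rV[R]_d) : Prop :=
  bounded_set P /\
  exists (N : nat) (Q : 'I_N -> set 'rV[R]_d),
    (forall i, polyhedron (Q i)) /\ P = \bigcup_(i in [set: 'I_N]) Q i.

Definition convex_polytope (R : realType) (d : nat) (P : set 'rV[R]_d) : Prop :=
  polytope P /\ @convex_set R 'rV[R]_d P.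

(* Y ord0 is the polytope A; the other Y k tessellate the closure of X \ A. *)
Definition tessellation (R : realType) (d m : nat) (X A : set 'rV[R]_d)
    (Y : 'I_m.+1 -> set 'rV[R]_d) : Prop :=
  [/\ Y ord0 = A,
      forall k, k != ord0 -> convex_polytope (Y k),
      closure (X `\` A) = \bigcup_(k in [set k | k != ord0]) Y k &
      forall k k', k != ord0 -> k' != ord0 -> k != k' ->
        (Y k)° `&` (Y k')° = set0].

Definition piecewise_affine (R : realType) (d m : nat)
    (Y : 'I_m.+1 -> set 'rV[R]_d) (g : 'I_m.+1 -> 'rV[R]_d)
    (b : 'I_m.+1 -> R) (V : 'rV[R]_d -> R) : Prop :=
  forall k x, Y k x -> V x = dot (g k) x + b k.

Definition sublevel (R : realType) (d : nat) (V : 'rV[R]_d -> R) (a : R) :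
  set 'rV[R]_d := [set x | V x < a].

(* Main.v *)
Require Import Defs.
From HB Require Import structures.
From mathcomp Require Import all_boot all_order all_algebra.
From mathcomp Require Import all_classical all_reals all_analysis.
From mathcomp Require Import ring lra.

Set Implicit Arguments.
Unset Strict Implicit.
Unset Printing Implicit Defensive.
Import Order.TTheory GRing.Theory Num.Theory.
Import numFieldNormedType.Exports.
Local Open Scope classical_set_scope.
Local Open Scope ring_scope.

(* The sublevel set K = {V <= V x0} is compact and contained in X, so on the part
   of K in each cell Y k (k != ord0) the derivative of V along f is at most -e for
   one e > 0.  Extend f to a Lipschitz field on the whole space and follow the
   global solution from x0: outside A, V decreases at rate at least e / 2, so the
   solution stays in K, and, V being bounded below on K, it hits A.  From that
   point on it agrees, by uniqueness, with a trajectory that converges to 0. *)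

(** * Coordinates, geometric limits and induction on the half-line *)

Lemma coord_norm_le (R : realType) d (v : 'rV[R]_d) i : `|v 0 i| <= `|v|.
Proof.
rewrite [leRHS]/Num.Def.normr/= mx_normrE.
exact: (le_bigmax _ (fun ij : 'I_1 * 'I_d => `|v ij.1 ij.2|) (0, i)).
Qed.

Lemma rV_norm_le (R : realType) d (v : 'rV[R]_d) (M : R) :
  0 <= M -> (forall i, `|v 0 i| <= M) -> `|v| <= M.
Proof.
move=> M0 vM; rewrite [leLHS]/Num.Def.normr/= mx_normrE.
by apply: bigmax_le => // -[i j] _ /=; rewrite (ord1 i).
Qed.

Lemma is_derive_rV (R : realType) d (x : R -> 'rV[R]_d) (v : 'rV[R]_d) (t : R) :
  is_derive t 1 x v <-> forall i, is_derive t 1 (fun s => x s 0 i) (v 0 i).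
Proof.
split=> [[xt <-] i|xi].
  have /derivable_mxP xti := xt.
  by apply: DeriveDef; [exact: xti|rewrite derive_mx// mxE].
have xt : derivable x t 1.
  by apply/derivable_mxP => i j; rewrite (ord1 i); case: (xi j).
apply: DeriveDef => //; rewrite derive_mx//; apply/rowP => j; rewrite mxE.
by case: (xi j).
Qed.

Lemma is_derive_continuous (R : realType) (V : normedModType R) (x : R -> V) v (t : R) :
  is_derive t 1 x v -> {for t, continuous x}.
Proof. by case=> + _; move/derivable1_diffP/differentiable_continuous. Qed.

Lemma cvg_half_pow (R : realType) (c : R) : c / 2 ^+ n @[n --> \oo] --> 0.
Proof.
rewrite -(mulr0 c); apply: cvgMr; under eq_fun do rewrite -exprVn.
by apply: cvg_expr; rewrite ger0_norm ?invr_ge0// invf_lt1// ltr1n.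
Qed.

(** Turns a bound on a distance that can be halved indefinitely into an equality. *)
Lemma le0_half_pow (R : realType) (a c : R) :
  (forall n, a <= c / 2 ^+ n) -> a <= 0.
Proof.
move=> h; have cv := cvg_half_pow c.
rewrite -(cvg_lim _ cv)//; apply: limr_ge; first by apply/cvg_ex; exists 0.
by apply: nearW.
Qed.

(** With [r n = 2 c / 2 ^+ n] one has [r n - r n.+1 = c / 2 ^+ n], so the intervals of centre [u n]
    and radius [r n] are nested. The supremum of their left ends lies in all of them. *)
Lemma geometric_limit (R : realType) (u : nat -> R) (c : R) :
  (forall n, `|u n.+1 - u n| <= c / 2 ^+ n) ->
  exists l, forall n, `|u n - l| <= c *+ 2 / 2 ^+ n.
Proof.
move=> uc; pose r n := c *+ 2 / 2 ^+ n.
have rS n : r n = r n.+1 + c / 2 ^+ n.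
  by rewrite /r exprS; field; rewrite expf_neq0.
have r0 n : 0 <= r n.
  by rewrite /r mulrnAl mulrn_wge0// (le_trans _ (uc n)).
have lo n m : u n - r n <= u (n + m)%N - r (n + m)%N.
  elim: m => [|m IH]; first by rewrite addn0.
  rewrite addnS (le_trans IH)// (rS (n + m)%N).
  by have := uc (n + m)%N; rewrite ler_norml => /andP[]; lra.
have hi n m : u (n + m)%N + r (n + m)%N <= u n + r n.
  elim: m => [|m IH]; first by rewrite addn0.
  rewrite addnS (le_trans _ IH)// (rS (n + m)%N).
  by have := uc (n + m)%N; rewrite ler_norml => /andP[]; lra.
have lohi n m : u n - r n <= u m + r m.
  rewrite (le_trans (lo n m))// (le_trans _ (hi m n))// addnC.
  by have := r0 (m + n)%N; lra.
pose S := [set u n - r n | n in [set: nat]].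
have ubS n : ubound S (u n + r n) by move=> _ [m _ <-].
exists (sup S) => n; rewrite ler_norml; apply/andP; split.
  rewrite lerBrDl lerBlDr; apply: ge_sup; last exact: ubS.
  by exists (u 0%N - r 0%N), 0%N.
rewrite lerBlDr -lerBlDl; apply: ub_le_sup; last by exists n.
by exists (u 0%N + r 0%N); exact: ubS.
Qed.

Lemma geometric_limit_rV (R : realType) d (u : nat -> 'rV[R]_d) (c : R) :
  (forall n, `|u n.+1 - u n| <= c / 2 ^+ n) ->
  exists l, forall n, `|u n - l| <= c *+ 2 / 2 ^+ n.
Proof.
move=> uc.
have /choice[l ul] : forall i, exists li,
    forall n, `|u n 0 i - li| <= c *+ 2 / 2 ^+ n.
  move=> i; apply: geometric_limit => n; apply: le_trans (uc n).
  by have := coord_norm_le (u n.+1 - u n) i; rewrite !mxE.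
exists (\row_i l i) => n; apply: rV_norm_le => [|i]; last by rewrite !mxE.
by rewrite mulrnAl mulrn_wge0// (le_trans _ (uc n)).
Qed.

(** If [P] fails somewhere, let [m] be the infimum of its failures. Then [P] holds before [m], hence
    at [m] by the limit hypothesis, hence slightly to the right of [m], which contradicts the choice
    of [m]. *)
Lemma real_induction (R : realType) (P : R -> Prop) :
  P 0 ->
  (forall t, 0 < t -> (forall s, 0 <= s < t -> P s) -> P t) ->
  (forall t, 0 <= t -> (forall s, 0 <= s <= t -> P s) ->
    \forall s \near t^'+, P s) ->
  forall t, 0 <= t -> P t.
Proof.
move=> P0 Plim Pnear t0 t00; apply: contrapT => Pt0.
pose S := [set s | 0 <= s /\ ~ P s].
have lbS : has_lbound S by exists 0 => s [].
have infS : has_inf S by split=> //; exists t0.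
have m0 : 0 <= inf S by apply: lb_le_inf; [exists t0|move=> s []].
have Plt s : 0 <= s < inf S -> P s.
  move=> /andP[s0 sm]; apply: contrapT => Ps.
  by have := ge_inf lbS (conj s0 Ps); rewrite leNgt sm.
have Pm : P (inf S).
  by move: m0; rewrite le_eqVlt => /predU1P[<-//|m0]; exact: Plim.
have Ple s : 0 <= s <= inf S -> P s.
  move=> /andP[s0]; rewrite le_eqVlt => /predU1P[->//|sm].
  by apply: Plt; rewrite s0.
have [e /= e0 Pe] := Pnear _ m0 Ple.
have : inf S + e <= inf S.
  apply: lb_le_inf => [|s [s0 Ps]]; first by exists t0.
  rewrite leNgt; apply/negP => se; apply: Ps.
  have [sm|ms] := leP s (inf S); first by apply: Ple; rewrite s0.
  by apply: Pe => //=; rewrite distrC gtr0_norm ?subr_gt0// ltrBlDl.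
by rewrite gerDl leNgt e0.
Qed.

(** * Global existence and uniqueness for a Lipschitz field *)

(* The lower bound -1, instead of 0, makes this differentiable at 0. *)
Definition primitive (R : realType) d (h : R -> 'rV[R]_d) (t : R) : 'rV[R]_d :=
  \row_i (\int[lebesgue_measure]_(s in `[-1, t]) (h s 0 i) -
          \int[lebesgue_measure]_(s in `[-1, 0%R]) (h s 0 i)).

Lemma primitive0 (R : realType) d (h : R -> 'rV[R]_d) : primitive h 0 = 0.
Proof. by apply/rowP => i; rewrite !mxE subrr. Qed.

Lemma is_derive_primitive (R : realType) d (h : R -> 'rV[R]_d) (t : R) :
  continuous h -> 0 <= t -> is_derive t 1 (primitive h) (h t).
Proof.
move=> hc t0; apply/is_derive_rV => i.
have hic : continuous (fun s => h s 0 i).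
  by move=> s; apply: (@continuous_comp _ _ _ h (fun v : 'rV[R]_d => v 0 i));
     [exact: hc|exact: coord_continuous].
(* The interval [[-1, t + 1]] has [t] in its interior even when [t = 0], so the derivative obtained
   is two-sided. *)
have [] := @continuous_FTC1_closed R (fun s => h s 0 i) (-1) t (t + 1).
- by rewrite ltrDl.
- apply: continuous_compact_integrable; first exact: segment_compact.
  exact: continuous_subspaceT.
- by rewrite (lt_le_trans _ t0)// oppr_lt0.
- exact: hic.
move=> dI; rewrite derive1E => vI.
set F := (fun s : R => _) in dI vI.
set c := \int[lebesgue_measure]_(s in `[-1, 0%R]) (h s 0 i).
have dF := DeriveDef dI vI.
have dc := is_derive_cst c t (1 : R).
have := is_deriveB dF dc; rewrite subr0.
by congr is_derive; apply/funext => s; rewrite mxE.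
Qed.

Lemma continuous_coord (R : realType) d (T : topologicalType)
    (u : T -> 'rV[R]_d) i : continuous u -> continuous (fun s => u s 0 i).
Proof.
move=> uc s; apply: (@continuous_comp _ _ _ u (fun v : 'rV[R]_d => v 0 i)).
  exact: uc.
exact: coord_continuous.
Qed.

(** The function [e s = C / 2 * expR (2 * L * s)] has the assumed bound on [w'] as its derivative.
    By the mean value theorem [w - e] does not exceed its value [- e 0 <= 0] at 0. *)
Lemma exp_comparison_coord (R : realType) (w w' : R -> R) (T C L : R) :
  0 <= C -> w 0 = 0 -> {within `[0, T], continuous w} ->
  (forall t : R, 0 < t < T -> is_derive t 1 w (w' t)) ->
  (forall t : R, 0 < t < T -> w' t <= C * L * expR (2 * L * t)) ->
  forall t : R, 0 <= t <= T -> w t <= C / 2 * expR (2 * L * t).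
Proof.
move=> C0 w0 wc dw w'le t /andP[t0 tT].
pose e (s : R) : R := C / 2 * expR (2 * L * s).
have de (s : R) : is_derive s 1 e (C * L * expR (2 * L * s)).
  by rewrite /e; apply: is_derive_eq; rewrite /GRing.scale/=; field.
have ce : continuous e by move=> r; exact: is_derive_continuous.
have e_ge0 r : 0 <= e r by rewrite mulr_ge0 ?expR_ge0// divr_ge0.
move: t0; rewrite le_eqVlt => /predU1P[t0|t0].
  by rewrite -t0 w0; exact: e_ge0.
have [|| s] := @MVT R (w - e)
    (fun s => w' s - C * L * expR (2 * L * s)) 0 t t0.
- move=> s; rewrite in_itv/= => /andP[s0 st].
  by apply: is_deriveB; apply: dw; rewrite s0 (lt_le_trans st).
- have wct : {within `[0, t], continuous w}.
    by apply: continuous_subspaceW wc; apply: subset_itvl; exact: tT.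
  have ect : {within `[0, t], continuous e} by exact: continuous_subspaceT.
  by move=> s; apply: continuousB (wct s) (ect s).
rewrite in_itv/= => /andP[s0 st] /eqP.
rewrite subr_eq => /eqP E.
have : w t - e t <= w 0 - e 0.
  rewrite -[leLHS]/((w - e) t) E gerDr pmulr_lle0 ?subr_gt0// subr_le0.
  by apply: w'le; rewrite s0 (lt_le_trans st).
by rewrite w0 -/(e t); have := e_ge0 0; lra.
Qed.

(* [u'] bounded by [C * L * exp (2 L t)] gains the factor [1 / 2] for [u]; this
   makes the Picard operator a contraction, globally in time. *)
Lemma exp_comparison (R : realType) d (u u' : R -> 'rV[R]_d) (T C L : R) :
  0 <= C -> u 0 = 0 -> {within `[0, T], continuous u} ->
  (forall t : R, 0 < t < T -> is_derive t 1 u (u' t)) ->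
  (forall t : R, 0 < t < T -> `|u' t| <= C * L * expR (2 * L * t)) ->
  forall t : R, 0 <= t <= T -> `|u t| <= C / 2 * expR (2 * L * t).
Proof.
move=> C0 u0 uc du u'le t tT.
apply: rV_norm_le => [|i]; first by rewrite mulr_ge0 ?expR_ge0// divr_ge0.
have uci : {within `[0, T], continuous (fun s => u s 0 i)}.
  exact: (@continuous_coord _ _ (subspace `[0, T]%classic) u).
have dui (s : R) : 0 < s < T -> is_derive s 1 (fun s => u s 0 i) (u' s 0 i).
  by move=> sT; have /is_derive_rV := du _ sT; exact.
have u'lei (s : R) : 0 < s < T -> `|u' s 0 i| <= C * L * expR (2 * L * s).
  by move=> sT; rewrite (le_trans (coord_norm_le _ _))// u'le.
rewrite ler_norml lerNl; apply/andP; split.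
  apply: (@exp_comparison_coord _ (fun s => - u s 0 i) (fun s => - u' s 0 i) T) => //.
  - by rewrite u0 mxE oppr0.
  - by move=> s; apply: continuousN; exact: uci.
  - by move=> s sT; apply: is_deriveN; exact: dui.
  - by move=> s sT; rewrite (le_trans _ (u'lei s sT))// -normrN ler_norm.
apply: (@exp_comparison_coord _ (fun s => u s 0 i) (fun s => u' s 0 i) T) => //.
  by rewrite u0 mxE.
by move=> s sT; rewrite (le_trans _ (u'lei s sT))// ler_norm.
Qed.

Lemma lipschitz_continuous (R : realType) (V W : normedModType R) (G : V -> W) (L : R) :
  (forall v w, `|G v - G w| <= L * `|v - w|) -> continuous G.
Proof.
move=> GL v; apply/cvgrPdist_le => /= e e0.
(* [L] has no prescribed sign; [|L| + 1] is positive and still a Lipschitz constant. *)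
have L1 : 0 < `|L| + 1 by rewrite ltr_wpDl.
near=> w.
rewrite (le_trans (GL _ _))// (@le_trans _ _ ((`|L| + 1) * `|v - w|))//.
  by rewrite ler_wpM2r// (le_trans (ler_norm L))// lerDl.
rewrite mulrC -ler_pdivlMr//.
near: w; apply: cvgr_dist_le => //; exact: divr_gt0.
Unshelve. all: by end_near. Qed.

(* Primitives are controlled on [0, +oo[ only; composing them with the absolute
   value keeps every iterate continuous on the whole line. *)
Fixpoint picard (R : realType) d (G : 'rV[R]_d -> 'rV[R]_d) (x0 : 'rV[R]_d)
    (n : nat) : R -> 'rV[R]_d :=
  if n is m.+1 then
    fun t => x0 + primitive (fun s => G (picard G x0 m s)) `|t|
  else fun=> x0.

Lemma continuous_primitive_norm (R : realType) d (h : R -> 'rV[R]_d) x0 :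
  continuous h -> continuous (fun t : R => x0 + primitive h `|t|).
Proof.
move=> hc t; have pc : {for t, continuous (primitive h \o @Num.norm R R)}.
  apply: continuous_comp; first exact: norm_continuous.
  exact: is_derive_continuous (is_derive_primitive hc (normr_ge0 t)).
exact: continuousD (@cst_continuous _ _ x0 t) pc.
Qed.

(** The contraction estimate: if [g] and [h] are images under an [L]-Lipschitz field of two curves
    at distance [C * expR (2 * L * t)], integration replaces [C] by [C / 2]. *)
Lemma primitive_dist (R : realType) d (g h : R -> 'rV[R]_d) (C L : R) :
  continuous g -> continuous h -> 0 <= C ->
  (forall t : R, 0 <= t -> `|g t - h t| <= C * L * expR (2 * L * t)) ->
  forall t : R, 0 <= t ->
    `|primitive g t - primitive h t| <= C / 2 * expR (2 * L * t).
Proof.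
move=> gc hc C0 gh t t0.
have du (s : R) : 0 <= s -> is_derive s 1 (primitive g - primitive h) (g s - h s).
  by move=> s0; apply: is_deriveB; exact: is_derive_primitive.
apply: (@exp_comparison _ _ (primitive g - primitive h) (fun s => g s - h s) t) => //.
- by rewrite -[LHS]/(primitive g 0 - primitive h 0) !primitive0 subrr.
- apply: continuous_in_subspaceT => s; rewrite inE/= in_itv/= => /andP[s0 _].
  exact: is_derive_continuous (du s s0).
- by move=> s /andP[s0 _]; apply: du; exact: ltW.
- by move=> s /andP[s0 _]; apply: gh; exact: ltW.
- by rewrite t0 lexx.
Qed.

(** Picard iteration converges geometrically relative to the weight [expR (2 * L * t)], on the whole
    half-line at once, so no local solutions have to be glued. *)
Lemma ode_existence (R : realType) d (G : 'rV[R]_d -> 'rV[R]_d) (L : R)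
    (x0 : 'rV[R]_d) :
  (forall v w, `|G v - G w| <= L * `|v - w|) ->
  exists x : R -> 'rV[R]_d,
    x 0 = x0 /\ forall t : R, 0 <= t -> is_derive t 1 x (G (x t)).
Proof.
wlog L0 : L / 0 < L.
  move=> H GL; apply: (H (`|L| + 1)); first by rewrite ltr_wpDl.
  move=> v w; rewrite (le_trans (GL v w))// ler_wpM2r//.
  by rewrite (le_trans (ler_norm L))// lerDl.
move=> GL; have Gc := lipschitz_continuous GL.
have Ghc (h : R -> 'rV[R]_d) : continuous h -> continuous (fun s => G (h s)).
  by move=> hc s; apply: (@continuous_comp _ _ _ h G); [exact: hc|exact: Gc].
pose u := picard G x0.
have uc n : continuous (u n).
  elim: n => [|n IH]; first exact: cst_continuous.
  exact/continuous_primitive_norm/Ghc.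
(* The iterates are even, so estimates on them need a proof for [t >= 0] only. *)
have uN n t : u n `|t| = u n t by case: n => [|n] //; rewrite /u/= normr_id.
(* The first increment has derivative [G x0], of norm [C * L]; this starts the induction on [n]. *)
pose C := `|G x0| / L.
have C0 : 0 <= C by rewrite divr_ge0// ltW.
pose E (t : R) := expR (2 * L * `|t|).
have step n t : `|u n.+1 t - u n t| <= (C * E t) / 2 ^+ n.
  rewrite -uN -(uN n) /E; move: `|t| (normr_ge0 t) => {}t t0.
  elim: n t t0 => [|n IH] t t0.
    rewrite expr0 divr1 /u/= ger0_norm// addrC addrA addNr add0r.
    have -> : C * expR (2 * L * t) = (C *+ 2) / 2 * expR (2 * L * t) by field.
    apply: (@exp_comparison _ _ _ (fun=> G x0) t); rewrite ?primitive0 ?t0 ?lexx//.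
    - by rewrite mulrn_wge0.
    - apply: continuous_in_subspaceT => s; rewrite inE/= in_itv/= => /andP[s0 _].
      exact: is_derive_continuous (is_derive_primitive (@cst_continuous _ _ _) s0).
    - by move=> s /andP[s0 _]; apply: is_derive_primitive (ltW s0); exact: cst_continuous.
    - move=> s /andP[s0 _].
      have -> : `|G x0| = C * L by rewrite /C divfK// gt_eqF.
      have : 1 <= expR (2 * L * s).
        by rewrite -expR0 ler_expR !mulr_ge0// ltW.
      have : 0 <= C * L by rewrite mulr_ge0// ltW.
      by nra.
  have -> : u n.+2 t - u n.+1 t = primitive (fun s => G (u n.+1 s)) t -
      primitive (fun s => G (u n s)) t.
    by rewrite /u/= ger0_norm// opprD addrACA subrr add0r.
  have -> : C * expR (2 * L * t) / 2 ^+ n.+1 = C / 2 ^+ n / 2 * expR (2 * L * t).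
    by rewrite exprS; field; rewrite expf_neq0.
  apply: primitive_dist => //.
  - exact: Ghc.
  - exact: Ghc.
  - by rewrite divr_ge0// exprn_ge0.
  move=> s s0; rewrite (le_trans (GL _ _))//.
  have -> : C / 2 ^+ n * L * expR (2 * L * s) = L * (C * expR (2 * L * s) / 2 ^+ n).
    by field; rewrite expf_neq0.
  by rewrite ler_pM2l// IH.
have /choice[x xE] : forall t, exists l, forall n,
    `|u n t - l| <= (C * E t) *+ 2 / 2 ^+ n.
  by move=> t; apply: geometric_limit_rV => n; exact: step.
have E0 t : 0 < E t by exact: expR_gt0.
have Ec : continuous E.
  move=> t; rewrite /E; apply: continuous_comp; last exact: continuous_expR.
  by apply: continuousM; [exact: cst_continuous|exact: norm_continuous].
(* A three-term estimate: one [n] serves all [s] with [E s <= E t + 1], and these [s] fill a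
   neighbourhood of [t] by continuity of [E]. *)
have xc : continuous x.
  move=> t; apply/cvgrPdist_le => /= e e0.
  pose M := C * (E t + 1) *+ 2.
  have M0 : 0 <= M by rewrite mulrn_wge0// mulr_ge0// addr_ge0// ltW.
  have [n nM] : exists n, M / 2 ^+ n <= e / 3.
    have /cvgrPdist_le/(_ (e / 3) (divr_gt0 e0 _))[//|n _ /(_ n (leqnn n))] := cvg_half_pow M.
    by rewrite /= sub0r normrN ger0_norm ?divr_ge0 ?exprn_ge0//; exists n.
  have xM s : E s <= E t + 1 -> `|u n s - x s| <= e / 3.
    move=> EsEt; rewrite (le_trans (xE s n))// (le_trans _ nM)//.
    by rewrite ler_wpM2r ?invr_ge0 ?exprn_ge0// lerMn2r/= ler_wpM2l.
  near=> s.
  have -> : e = e / 3 + (e / 3 + e / 3) by field.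
  rewrite -(subrKA (u n t)) -(subrKA (u n s) (u n t)).
  rewrite (le_trans (ler_normD _ _))// lerD//.
    by rewrite distrC xM// lerDl.
  rewrite (le_trans (ler_normD _ _))// lerD//.
    by near: s; apply: cvgr_dist_le; [exact: uc|exact: divr_gt0].
  by rewrite xM//; near: s; apply: (cvgr_le _ (Ec t)); rewrite ltrDl.
(* The limit [x] of even functions may fail to be differentiable at 0. The solution is [y], which
   agrees with [x] for [t >= 0] and has a two-sided derivative at 0. *)
pose y t := x0 + primitive (fun s => G (x s)) t.
have yx t : 0 <= t -> y t = x t.
  move=> t0; apply/eqP; rewrite -subr_eq0 -normr_le0.
  (* Both [y t] and [x t] are within [C * E t / 2 ^+ n] of [u n.+1 t]. *)
  apply: (@le0_half_pow _ _ (C * E t *+ 2)) => n.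
  have yu : `|y t - u n.+1 t| <= C * E t / 2 ^+ n.
    have -> : y t - u n.+1 t = primitive (fun s => G (x s)) t -
        primitive (fun s => G (u n s)) t.
      by rewrite /u/= ger0_norm// opprD addrACA subrr add0r.
    have -> : C * E t / 2 ^+ n = (C *+ 2 / 2 ^+ n) / 2 * expR (2 * L * t).
      by rewrite /E ger0_norm//; field; rewrite expf_neq0.
    apply: primitive_dist => //.
    - exact: Ghc.
    - exact: Ghc.
    - by rewrite divr_ge0 ?exprn_ge0// mulrn_wge0.
    move=> s s0; rewrite (le_trans (GL _ _))// distrC.
    have -> : C *+ 2 / 2 ^+ n * L * expR (2 * L * s) = L * (C * E s *+ 2 / 2 ^+ n).
      by rewrite /E ger0_norm//; field; rewrite expf_neq0.
    by rewrite ler_pM2l.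
  rewrite -(subrKA (u n.+1 t)) (le_trans (ler_normD _ _))//.
  rewrite (le_trans (lerD yu (xE _ _)))//.
  by rewrite exprS le_eqVlt; apply/orP; left; apply/eqP; field; rewrite expf_neq0.
exists y; split=> [|t t0]; first by rewrite /y primitive0 addr0.
rewrite (yx t t0).
have := is_deriveD (is_derive_cst x0 t (1 : R)) (is_derive_primitive (Ghc _ xc) t0).
by rewrite add0r.
Unshelve. all: by end_near. Qed.

(** On [[0, T]] the distance is bounded by some [B], by compactness. Each use of [exp_comparison] on
    the difference halves the constant in front of [expR (2 * L * t)], so the distance vanishes. *)
Lemma ode_uniqueness (R : realType) d (G : 'rV[R]_d -> 'rV[R]_d) (L : R)
    (x y : R -> 'rV[R]_d) :
  (forall v w, `|G v - G w| <= L * `|v - w|) ->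
  x 0 = y 0 ->
  {within `[0, +oo[, continuous x} -> {within `[0, +oo[, continuous y} ->
  (forall t : R, 0 < t -> is_derive t 1 x (G (x t))) ->
  (forall t : R, 0 < t -> is_derive t 1 y (G (y t))) ->
  forall t : R, 0 <= t -> x t = y t.
Proof.
wlog L0 : L / 0 < L.
  move=> H GL; apply: (H (`|L| + 1)); first by rewrite ltr_wpDl.
  move=> v w; rewrite (le_trans (GL v w))// ler_wpM2r//.
  by rewrite (le_trans (ler_norm L))// lerDl.
move=> GL xy0 xc yc dx dy T T0.
have uc : {within `[0, T], continuous (x - y)}.
  have sub : `[0, T] `<=` `[0, +oo[ by move=> s /=; rewrite !in_itv/= => /andP[->].
  have xT := continuous_subspaceW sub xc.
  have yT := continuous_subspaceW sub yc.
  by move=> s; apply: continuousB (xT s) (yT s).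
have [B [B0 uB]] : exists B, 0 <= B /\ forall t, 0 <= t <= T -> `|x t - y t| <= B.
  have /compact_bounded[M [_ Mu]] := continuous_compact uc (@segment_compact _ _ _).
  exists (`|M| + 1); split=> [|t tT]; first by rewrite addr_ge0.
  apply: (Mu (`|M| + 1)); first by rewrite (le_lt_trans (ler_norm M))// ltrDl.
  by exists t => //=; rewrite in_itv.
have bound n t : 0 <= t <= T -> `|x t - y t| <= B / 2 ^+ n * expR (2 * L * t).
  elim: n t => [|n IH] t tT.
    rewrite expr0 divr1 (le_trans (uB t tT))// ler_peMr// -expR0 ler_expR.
    by case/andP: tT => t0 _; rewrite !mulr_ge0// ltW.
  have -> : B / 2 ^+ n.+1 = B / 2 ^+ n / 2 by rewrite exprS; field; rewrite expf_neq0.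
  apply: (@exp_comparison _ _ (x - y) (fun s => G (x s) - G (y s)) T) => //.
  - by rewrite divr_ge0// exprn_ge0.
  - by rewrite -[LHS]/(x 0 - y 0) xy0 subrr.
  - by move=> s /andP[s0 _]; apply: is_deriveB; [exact: dx|exact: dy].
  - move=> s /andP[s0 sT]; rewrite (le_trans (GL _ _))//.
    by rewrite (mulrC _ L) -(mulrA L) ler_pM2l// IH// (ltW s0) (ltW sT).
apply/eqP; rewrite -subr_eq0 -normr_le0.
apply: (@le0_half_pow _ _ (B * expR (2 * L * T))) => n.
by rewrite mulrAC bound// T0 lexx.
Qed.

(** * Lipschitz extension and comparison of norms *)

Lemma mcshane_coord (R : realType) (V : normedModType R) (X : set V)
    (f : V -> R) (L : R) :
  0 <= L -> X !=set0 ->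
  (forall x y, X x -> X y -> `|f x - f y| <= L * `|x - y|) ->
  exists g : V -> R, (forall x, X x -> g x = f x) /\
    forall x y, `|g x - g y| <= L * `|x - y|.
Proof.
move=> L0 [x0 Xx0] fL.
(* McShane's formula: the extension is the infimum over [y] in [X] of the [L]-Lipschitz functions
   [f y + L * |x - y|], finite because [f] is Lipschitz on [X]. *)
pose S x := [set f y + L * `|x - y| | y in X].
have S0 x : S x !=set0 by exists (f x0 + L * `|x - x0|), x0.
have lbS x : has_lbound (S x).
  exists (f x0 - L * `|x0 - x|) => _ [y Xy <-].
  have := fL _ _ Xx0 Xy; rewrite ler_norml => /andP[_].
  have : L * `|x0 - y| <= L * (`|x0 - x| + `|x - y|) by rewrite ler_wpM2l// ler_distD.
  lra.
have gle x y : inf (S x) <= inf (S y) + L * `|x - y|.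
  rewrite -lerBlDr; apply: lb_le_inf => // _ [z Xz <-]; rewrite lerBlDr.
  have : inf (S x) <= f z + L * `|x - z| by apply: ge_inf => //; exists z.
  have : L * `|x - z| <= L * (`|x - y| + `|y - z|) by rewrite ler_wpM2l// ler_distD.
  lra.
exists (fun x => inf (S x)); split=> [x Xx|x y].
  apply/eqP; rewrite eq_le; apply/andP; split.
    by apply: ge_inf => //; exists x => //; rewrite subrr normr0 mulr0 addr0.
  apply: lb_le_inf => // _ [y Xy <-].
  by have := fL _ _ Xx Xy; rewrite ler_norml => /andP[_]; lra.
rewrite ler_norml; have := gle x y; have := gle y x; rewrite (distrC y x).
by move=> ? ?; apply/andP; split; lra.
Qed.

(** Coordinates are extended separately; the constant is kept because the norm is the largest
    absolute value of a coordinate. *)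
Lemma mcshane (R : realType) d (X : set 'rV[R]_d) (f : 'rV[R]_d -> 'rV[R]_d) (L : R) :
  0 <= L -> X !=set0 ->
  (forall x y, X x -> X y -> `|f x - f y| <= L * `|x - y|) ->
  exists g : 'rV[R]_d -> 'rV[R]_d, (forall x, X x -> g x = f x) /\
    forall x y, `|g x - g y| <= L * `|x - y|.
Proof.
move=> L0 X0 fL.
have /choice[g gP] : forall i, exists gi : 'rV[R]_d -> R,
    (forall x, X x -> gi x = f x 0 i) /\ forall x y, `|gi x - gi y| <= L * `|x - y|.
  move=> i; apply: mcshane_coord => // x y Xx Xy; apply: le_trans (fL x y Xx Xy).
  by have := coord_norm_le (f x - f y) i; rewrite !mxE.
exists (fun x => \row_i g i x); split=> [x Xx|x y].
  by apply/rowP => i; rewrite mxE (gP i).1.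
by apply: rV_norm_le => [|i]; [rewrite mulr_ge0|rewrite !mxE; exact: (gP i).2].
Qed.

Lemma norm_le_qnorm (R : realType) d (q : \bar R) (x : 'rV[R]_d) :
  (1 <= q)%E -> `|x| <= qnorm q x.
Proof.
case: q => [r||]//=; rewrite lee_fin => r1.
have r0 : 0 < r by rewrite (lt_le_trans _ r1).
have s0 : 0 <= \sum_(i < d) `|x 0 i| `^ r by apply: sumr_ge0 => i _; exact: powR_ge0.
apply: rV_norm_le => [|i]; first exact: powR_ge0.
have powRK (a : R) : 0 <= a -> (a `^ r) `^ r^-1 = a.
  by move=> a0; rewrite -powRrM mulfV ?powRr1// gt_eqF.
rewrite -[leLHS]powRK//.
apply: ge0_ler_powR; rewrite ?nnegrE ?invr_ge0 ?powR_ge0 ?(ltW r0)//.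
by rewrite (bigD1 i)//= lerDl sumr_ge0// => j _; exact: powR_ge0.
Qed.

Lemma qnorm_le_norm (R : realType) d (q : \bar R) : (1 <= q)%E ->
  exists C : R, 0 <= C /\ forall x : 'rV[R]_d, qnorm q x <= C * `|x|.
Proof.
case: q => [r||]//=; last by exists 1; split=> // x; rewrite mul1r.
rewrite lee_fin => r1.
have r0 : 0 < r by rewrite (lt_le_trans _ r1).
exists (d%:R `^ r^-1); split=> [|x]; first exact: powR_ge0.
have powRK (a : R) : 0 <= a -> (a `^ r) `^ r^-1 = a.
  by move=> a0; rewrite -powRrM mulfV ?powRr1// gt_eqF.
rewrite -[X in _ * X]powRK// -powRM ?powR_ge0//.
apply: ge0_ler_powR; rewrite ?nnegrE ?invr_ge0 ?mulr_ge0 ?powR_ge0 ?(ltW r0)//.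
  by apply: sumr_ge0 => i _; exact: powR_ge0.
rewrite mulr_natl -[X in _ *+ X]card_ord -sumr_const; apply: ler_sum => i _.
by apply: ge0_ler_powR; rewrite ?nnegrE ?(ltW r0)// coord_norm_le.
Qed.

(** * Linear forms and polytopes *)

Lemma dot_lipschitz (R : realType) d (c v w : 'rV[R]_d) :
  `|dot c v - dot c w| <= (\sum_(i < d) `|c 0 i|) * `|v - w|.
Proof.
rewrite /dot -sumrB mulr_suml (le_trans (ler_norm_sum _ _ _))// ler_sum// => i _.
rewrite -mulrBr normrM ler_wpM2l//.
by have := coord_norm_le (v - w) i; rewrite !mxE.
Qed.

Lemma continuous_dot (R : realType) d (c : 'rV[R]_d) :
  continuous (dot c : 'rV[R]_d -> R).
Proof. exact: lipschitz_continuous (dot_lipschitz c). Qed.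

Lemma dotC (R : realType) d (v w : 'rV[R]_d) : dot v w = dot w v.
Proof. by apply: eq_bigr => i _; rewrite mulrC. Qed.

Lemma is_derive_dot (R : realType) d (c : 'rV[R]_d) (x : R -> 'rV[R]_d) v (t : R) :
  is_derive t 1 x v -> is_derive t 1 (fun s => dot c (x s)) (dot c v).
Proof.
move=> /is_derive_rV dx.
have := is_derive_sum (fun i => is_deriveZ (c 0 i) (dx i)).
by congr is_derive; apply/funext => s; rewrite fct_sumE.
Qed.

Lemma closed_polyhedron (R : realType) d (P : set 'rV[R]_d) :
  polyhedron P -> closed P.
Proof.
move=> [p [C [c ->]]].
rewrite (_ : mkset _ = \bigcap_i (dot (C i) @^-1` [set r | r <= c i])).
  apply: closed_bigI => i _; apply: preimage_closed; last exact: closed_le.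
  by move=> v _; exact: continuous_dot.
by apply/seteqP; split=> [x Cx i _|x Cx i]; exact: Cx.
Qed.

Lemma closed_polytope (R : realType) d (P : set 'rV[R]_d) : polytope P -> closed P.
Proof.
move=> [_ [N [Q [Qp ->]]]]; apply: closed_bigcup; first exact: finite_finset.
by move=> i _; exact: closed_polyhedron.
Qed.

(** * Decrease of [V] along a solution *)

Lemma is_derive_lt_near_right (R : realType) (w : R -> R) (t D r : R) :
  is_derive t 1 w D -> D < r ->
  \forall s \near t^'+, w s <= w t + r * (s - t).
Proof.
move=> [wt <-] Dr.
(* The strict gap [D < r] absorbs the remainder: difference quotients close to [t] are below [r]. *)
have := cvgr_lt _ wt _ Dr => -[e /= e0 He].
exists e => //= s /= se ts.
have st0 : 0 < s - t by rewrite subr_gt0.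
have se0 : `|0 - (s - t)| < e by rewrite sub0r opprB.
have st_neq0 : s - t != 0 by rewrite gt_eqF.
have := He (s - t) se0 st_neq0.
rewrite /GRing.scale/= mulr1 subrK mulrC ltr_pdivrMr// => /ltW; lra.
Qed.

(** On each nonempty compact piece of [K] in [Y k] the function [h k] attains a negative maximum.
    There are finitely many [k], so a minimum of the resulting gaps serves; empty pieces get the
    default 1. *)
Lemma decrease_uniform (R : realType) d (T : finType) (P : pred T) (K : set 'rV[R]_d)
    (Y : T -> set 'rV[R]_d) (h : T -> 'rV[R]_d -> R) :
  compact K -> (forall k, P k -> closed (Y k)) -> (forall k, continuous (h k)) ->
  (forall k x, P k -> K x -> Y k x -> h k x < 0) ->
  exists2 e : R, 0 < e & forall k x, P k -> K x -> Y k x -> h k x <= - e.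
Proof.
move=> Kc Yc hc hneg.
have /choice[e eP] : forall k, exists e : R, 0 < e /\
    (P k -> forall x, K x -> Y k x -> h k x <= - e).
  move=> k; have [Pk|nPk] := boolP (P k); last by exists 1; split.
  have [KY0|/nonemptyPn KY0] := pselect (K `&` Y k !=set0); last first.
    exists 1; split=> // _ x Kx Yx; have : (K `&` Y k) x by [].
    by rewrite KY0.
  have [x] := compact_EVT_max KY0 (compact_closedI Kc (Yc k Pk))
    (continuous_subspaceT (hc k)).
  rewrite inE => -[Kx Yx] xmax; exists (- h k x); split.
    by rewrite oppr_gt0 hneg.
  by move=> _ y Ky Yy; rewrite opprK xmax// inE.
exists (\big[Order.min/1]_k e k).
  by apply/bigmin_gtP; split=> // k _; exact: (eP k).1.
move=> k x Pk Kx Yx; rewrite (le_trans ((eP k).2 Pk x Kx Yx))// lerN2.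
exact: bigmin_le.
Qed.

(** The cells are closed and finitely many, so those that miss [v] also miss a neighbourhood of [v].
    A point [w] of [X] outside [A] close to [v] lies in some cell, which must then contain [v]. *)
Lemma tessellation_near (R : realType) d m (X A : set 'rV[R]_d)
    (Y : 'I_m.+1 -> set 'rV[R]_d) (v : 'rV[R]_d) :
  open X -> closed A -> tessellation X A Y -> X v -> ~ A v ->
  \forall w \near v, exists k, [/\ k != ord0, Y k v & Y k w].
Proof.
move=> oX cA [_ Yp XAY _] Xv Av.
have XAw : \forall w \near v, X w /\ ~ A w.
  have nA : nbhs v (~` A) by apply: open_nbhs_nbhs; split=> //; exact: closed_openC.
  have nX : nbhs v X by exact: open_nbhs_nbhs.
  exact: (filterI nX nA).
have Yw : \forall w \near v, forall k, k != ord0 -> ~ Y k v -> ~ Y k w.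
  apply: (@filter_forall _ _ _ (nbhs v)) => k; have [k0|k0] := eqVneq k ord0.
    by apply: nearW => w; rewrite k0.
  have [Ykv|Ykv] := pselect (Y k v); first by apply: nearW.
  have : \forall w \near v, ~ Y k w.
    apply: open_nbhs_nbhs; split=> //; apply: closed_openC.
    by apply: closed_polytope; case: (Yp k k0).
  by apply: filterS.
near=> w.
have : closure (X `\` A) w by apply: subset_closure; near: w.
rewrite XAY => -[k /= k0 Ykw]; exists k; split=> //.
by apply: contrapT => Ykv; move: Ykw; apply: (near Yw w).
Unshelve. all: by end_near. Qed.

(** [V] may have a kink at [x t]. Still, for [s] slightly after [t] some cell contains both [x t]
    and [x s], and there [V] is a single affine function; the cell may change with [s], so the slope
    bound is taken for all cells at [x t] at once. *)
Lemma piecewise_affine_decrease (R : realType) d m (X A : set 'rV[R]_d)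
    (Y : 'I_m.+1 -> set 'rV[R]_d) (g : 'I_m.+1 -> 'rV[R]_d) (b : 'I_m.+1 -> R)
    (V : 'rV[R]_d -> R) (x : R -> 'rV[R]_d) (u : 'rV[R]_d) (t r : R) :
  open X -> closed A -> tessellation X A Y -> piecewise_affine Y g b V ->
  is_derive t 1 x u -> X (x t) -> ~ A (x t) ->
  (forall k, k != ord0 -> Y k (x t) -> dot (g k) u < r) ->
  \forall s \near t^'+, V (x s) <= V (x t) + r * (s - t).
Proof.
move=> oX cA hY hV dx Xx Ax gr.
have Yx : \forall s \near t^'+, exists k, [/\ k != ord0, Y k (x t) & Y k (x s)].
  have xt : x s @[s --> t^'+] --> x t.
    exact: cvg_at_right_filter (is_derive_continuous dx).
  exact: xt (tessellation_near oX cA hY Xx Ax).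
have gx : \forall s \near t^'+, forall k, k != ord0 -> Y k (x t) ->
    dot (g k) (x s) <= dot (g k) (x t) + r * (s - t).
  apply: filter_forall => k; have [k0|k0] := eqVneq k ord0.
    by apply: nearW.
  have [Ykx|Ykx] := pselect (Y k (x t)); last by apply: nearW.
  have := is_derive_lt_near_right (is_derive_dot (g k) dx) (gr k k0 Ykx).
  by apply: filterS.
apply: filterS2 Yx gx => s [k [k0 Ykt Yks]] /(_ k k0 Ykt) gks.
by rewrite (hV _ _ Ykt) (hV _ _ Yks) addrAC lerD2r.
Qed.

(** The local rate is required only as long as [phi] has stayed below [phi 0]. As [r <= 0], the
    bound being proved supplies exactly this, and the induction closes. *)
Lemma decrease_along (R : realType) (phi : R -> R) (r : R) :
  r <= 0 ->
  (forall t, 0 <= t -> {for t, continuous phi}) ->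
  (forall t, 0 <= t -> (forall s, 0 <= s <= t -> phi s <= phi 0) ->
    \forall s \near t^'+, phi s <= phi t + r * (s - t)) ->
  forall t, 0 <= t -> phi t <= phi 0 + r * t.
Proof.
move=> r0 phic phir; apply: real_induction => [|t t0 Pt|t t0 Pt].
- by rewrite mulr0 addr0.
(* If the bound failed at [t], it would fail just before [t] too, by continuity of
   [phi s - r * s]. *)
- rewrite leNgt; apply/negP => ltphi.
  have phirc : (phi s - r * s) @[s --> t] --> phi t - r * t.
    apply: cvgB; first exact: phic (ltW t0).
    by apply: cvgM; [exact: cvg_cst|exact: cvg_id].
  have gt0 : phi 0 < phi t - r * t by rewrite ltrBrDr.
  near t^'- => s.
  have : phi 0 < phi s - r * s.
    by near: s; apply: cvgr_gt gt0; exact: cvg_at_left_filter.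
  have /Pt : 0 <= s < t.
    by apply/andP; split; [apply/ltW; near: s; exact: nbhs_left_gt|near: s; exact: nbhs_left_lt].
  by rewrite ltrBrDr ltNge => ->.
have : \forall s \near t^'+, phi s <= phi t + r * (s - t).
  apply: phir => // s /[dup] st /Pt; case/andP: st => s0 _.
  by have : r * s <= 0 by [rewrite mulr_le0_ge0]; lra.
apply: filterS => s; have := Pt t; rewrite t0 lexx => /(_ isT); lra.
Unshelve. all: by end_near. Qed.

Lemma is_derive_time_shift (R : realType) d (x : R -> 'rV[R]_d) v (t T : R) :
  is_derive (t + T) 1 x v -> is_derive t 1 (fun s => x (s + T)) v.
Proof.
move=> /is_derive_rV dx; apply/is_derive_rV => i.
have := @is_derive1_comp _ (fun s => x s 0 i) (fun s => s + T) t (v 0 i) 1 (dx i).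
rewrite mulr1; apply.
exact: is_derive_shift.
Qed.

(** * Attraction from a sublevel set of [V] *)

Theorem proposition6 (R : realType) (d : nat)
  (q : \bar R) (hq : (1 <= q)%E)
  (X : set 'rV[R]_d) (hXbounded : bounded_set X) (hXopen : open X)
  (f : 'rV[R]_d -> 'rV[R]_d)
  (hf : lipschitz_field q X f)
  (h0X : X 0) (hequilibrium : single_equilibrium X f)
  (hstable : locally_asymptotically_stable q X f)
  (n : nat) (xD fD : 'I_n -> 'rV[R]_d)
  (hD : forall i, X (xD i) /\ fD i = f (xD i))
  (F : 'rV[R]_d -> set 'rV[R]_d)
  (hF : forall x, X x ->
     [/\ compact (F x), @convex_set R 'rV[R]_d (F x) & F x (f x)])
  (A : set 'rV[R]_d) (hAcompact : compact A)
  (hAR : A `<=` (region_of_attraction q X f)°) (h0A : A° 0)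
  (hXpolytope : polytope (closure X)) (hApolytope : polytope A)
  (m : nat) (Y : 'I_m.+1 -> set 'rV[R]_d) (hY : tessellation X A Y)
  (g : 'I_m.+1 -> 'rV[R]_d) (b : 'I_m.+1 -> R)
  (V : 'rV[R]_d -> R) (hV : piecewise_affine Y g b V)
  (hVcontinuous : {within closure X, continuous V})
  (L : R) (hVlipschitz : lipschitz_constant q (closure X) V L)
  (hVextension : lipschitz_constant q [set: 'rV[R]_d] V L)
  (hdecrease : forall k, k != ord0 ->
     forall x, Y k x -> forall v, F x v -> dot v (g k) < 0) :
  forall a : R, sublevel V a `<=` X ->
    sublevel V a `<=` region_of_attraction q X f.
Proof.
move=> a aX x0 x0a.
have cA : closed A by apply: compact_closed hAcompact; exact: norm_hausdorff.
have [C [C0 qC]] := qnorm_le_norm d hq.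
have [G [Gf [M GM]]] : exists G : 'rV[R]_d -> 'rV[R]_d, (forall x, X x -> G x = f x) /\
    exists M, forall v w, `|G v - G w| <= M * `|v - w|.
  have [l fl] := hf.
  (* The factor [C] pays for passing from the [q]-norm to the maximum norm on the right; on the left
     the maximum norm is the smaller one. *)
  have [|||G [Gf GM]] := @mcshane R d X f (`|l| * C).
  - by rewrite mulr_ge0.
  - by exists 0.
  - move=> x y Xx Xy; rewrite (le_trans (norm_le_qnorm _ hq))// (le_trans (fl x y Xx Xy))//.
    rewrite -mulrA (@le_trans _ _ (`|l| * qnorm q (x - y)))//.
      rewrite ler_wpM2r ?ler_norm//.
      exact: le_trans (normr_ge0 _) (norm_le_qnorm _ hq).
    by rewrite ler_wpM2l.
  by exists G; split=> //; exists (`|l| * C).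
have Gc := lipschitz_continuous GM.
have Vc : continuous V.
  have [[L0 VL] _] := hVextension.
  apply: (@lipschitz_continuous _ _ _ _ (L * C)) => v w.
  by rewrite (le_trans (VL v w _ _))// -mulrA ler_wpM2l.
have [x [xx0 dx]] := ode_existence x0 GM.
have xc t : 0 <= t -> {for t, continuous x}.
  by move=> t0; exact: is_derive_continuous (dx t t0).
pose K := [set v | V v <= V x0].
have KX : K `<=` X by move=> v Kv; apply: aX; exact: le_lt_trans Kv x0a.
(* [K] is closed in the whole space because the extended [V] is continuous there, and bounded
   because [X] is. *)
have Kc : compact K.
  apply: bounded_closed_compact.
    by have [N [Nreal NX]] := hXbounded; exists N; split=> // r Nr v /KX; exact: NX.
  rewrite (_ : K = V @^-1` [set r | r <= V x0])//.
  by apply: preimage_closed; [move=> v _; exact: Vc|exact: closed_le].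
have [e e0 eP] : exists2 e : R, 0 < e &
    forall k v, k != ord0 -> K v -> Y k v -> dot (g k) (G v) <= - e.
  apply: (@decrease_uniform _ _ _ (fun k => k != ord0) K Y
    (fun k v => dot (g k) (G v))) => //.
  - by move=> k k0; apply: closed_polytope; case: hY => _ /(_ k k0)[].
  - by move=> k v; apply: continuous_comp; [exact: Gc|exact: continuous_dot].
  (* On [K] the extension [G] is [f], and [f v] is one of the velocities in [F v]. *)
  - move=> k v k0 Kv Yv; rewrite dotC (hdecrease _ k0 _ Yv)// Gf; last exact: KX.
    by case: (hF _ (KX _ Kv)).
have [T [T0 AxT Kx]] : exists T, [/\ 0 <= T, A (x T) &
    forall t, 0 <= t <= T -> K (x t)].
  apply: contrapT => noT.
  (* The rate is [e / 2] because the local decrease lemma needs a slope strictly above the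
     derivative bound [- e]. *)
  have Vdec : forall t, 0 <= t -> V (x t) <= V (x 0) + (- (e / 2)) * t.
    apply: (@decrease_along _ (V \o x)) => [|t t0|t t0 Vt].
    - by rewrite oppr_le0 divr_ge0// ltW.
    - by apply: continuous_comp; [exact: xc|exact: Vc].
    (* Staying below [V x0] up to [t] means staying in [K], so by [noT] the point [x t] is outside
       [A]. *)
    have Kt s : 0 <= s <= t -> K (x s) by move=> /Vt; rewrite /= xx0.
    have Kxt : K (x t) by apply: Kt; rewrite t0 lexx.
    apply: (piecewise_affine_decrease hXopen cA hY hV (dx t t0)).
    - exact: KX.
    - by move=> Axt; apply: noT; exists t.
    - by move=> k k0 Yk; rewrite (le_lt_trans (eP k _ k0 Kxt Yk))// ltrN2; lra.
  have [v Kv vmin] : exists2 v, v \in K & forall w, w \in K -> V v <= V w.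
    have K0 : K !=set0 by exists x0; rewrite /K/=.
    exact: compact_EVT_min K0 Kc (continuous_subspaceT Vc).
  (* At this time the decrease gives [V (x t) <= V v - 1]; then [x t] is in [K] and lies below the
     minimum of [V] on [K]. *)
  pose t := (V x0 - V v + 1) / (e / 2).
  have vx0 : V v <= V x0 by apply: vmin; rewrite inE /K/=.
  have t0 : 0 <= t by rewrite divr_ge0 ?divr_ge0 ?(ltW e0)// addr_ge0// subr_ge0.
  have := Vdec t t0; rewrite xx0 mulNr mulrC divfK; last by rewrite gt_eqF ?divr_gt0.
  move=> Vxt; have : V v <= V (x t) by apply: vmin; rewrite inE /K/=; lra.
  by lra.
have [XxT [y [[y0 Xy yc dy] ytend]]] := interior_subset (hAR _ AxT).
(* The trajectory [y] stays in [X], where [G] is [f], so it also solves the extended equation and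
   uniqueness applies. *)
have xy t : 0 <= t -> x (t + T) = y t.
  apply: (@ode_uniqueness _ _ G M (fun s => x (s + T)) y GM) => //=.
  - by rewrite add0r y0.
  - apply: continuous_in_subspaceT => s; rewrite inE/= in_itv/= andbT => s0.
    apply: is_derive_continuous (is_derive_time_shift (dx _ _)).
    by rewrite addr_ge0.
  - by move=> s s0; apply/is_derive_time_shift/dx; rewrite addr_ge0// ltW.
  - by move=> s s0; rewrite Gf; [exact: dy|exact/Xy/ltW].
have xyT t : T <= t -> x t = y (t - T) by move=> Tt; rewrite -xy ?subr_ge0// subrK.
have Xx t : 0 <= t -> X (x t).
  move=> t0; have [tT|/ltW Tt] := leP t T; first by apply/KX/Kx; rewrite t0.
  by rewrite xyT//; apply: Xy; rewrite subr_ge0.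
split; first by apply: KX; rewrite /K/=.
exists x; split; first split=> //.
- apply: continuous_in_subspaceT => s; rewrite inE/= in_itv/= andbT.
  exact: xc.
- by move=> t t0; rewrite -Gf; [exact/dx/ltW|exact/Xx/ltW].
apply/cvgrPdist_le => /= r r0.
have [N [Nreal yN]] := (cvgrPdist_le _ _).1 ytend r r0.
(* [N + T] is the threshold for [y] moved by the hitting time; [N] may be negative, and [T] ensures
   that [x t] is already given by [y]. *)
exists (Num.max (N + T) T); split; first exact: num_real.
move=> t; rewrite gt_max => /andP[NTt Tt].
by rewrite xyT ?(ltW Tt)//; apply: yN; rewrite ltrBrDr.
Qed.
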